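(* Let $K$ be a field of characteristic zero and $r\ge2$. Let $P(\underline u,y)=\sum_{\underline i\in\mathbb N^r}\sum_{j=0}^{d_y}a_{\underline i,j}\underline u^{\underline i}y^j\in K[[\underline u]][y]$ be a nonzero polynomial of degree in $y$ bounded by $d_y$, and let $y_0=\sum_{\underline n\in\mathbb N^r}c_{\underline n}\underline u^{\underline n}\in K[[\underline u]]$, $c_{\underline0}\ne0$, be a simple root of $P$. Let $\underline k_0$, $\underline i_{\underline k}$, $P_{\underline k}$, $z_{\underline k}$ and $\omega_0\neq 0$ be as defined in the context. Then, for any $\underline k>_{\mathrm{grlex}}\underline k_0$: - either the polynomial $z_{S(\underline k)}=\sum_{\underline n\le_{\mathrm{grlex}}S(\underline k)}c_{\underline n}\underline u^{\underline n}$ is a solution of $P(\underline u,y)=0$; - or $$ {}_{\underline k}R(\underline u,y):=\frac{P_{\underline k}(\underline u,\,y+c_{S(\underline k)})}{-\omega_0\,\underline u^{\underline i_{\underline k}}}=-y+{}_{\underline k}Q(\underline u,y)\in K((u_1^{\mathbb Z},\dots,u_r^{\mathbb Z}))^{\mathrm{grlex}}_{\mathrm{Mod}}[y]$$ defines a strongly reduced Henselian equation $y={}_{\underline k}Q(\underline u,y)$, which is satisfied by $$t_{S(\underline k)}:=\frac{y_0-z_{S(\underline k)}}{\underline u^{S(\underline k)}}=c_{S^2(\underline k)}\underline u^{S^2(\underline k)-S(\underline k)}+c_{S^3(\underline k)}\underline u^{S^3(\underline k)-S(\underline k)}+\cdots.$$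
   Context: For $\underline n\in\mathbb Z^r$, $|\underline n|=n_1+\cdots+n_r$; $\underline n<_{\mathrm{grlex}}\underline m$ iff $|\underline n|<|\underline m|$, or $|\underline n|=|\underline m|$ and $\underline n<_{\mathrm{lex}}\underline m$. $S(\underline k)$ is the successor of $\underline k$ in $(\mathbb N^r,\le_{\mathrm{grlex}})$ ($\mathbb N=\mathbb Z_{\ge0}$), and $S^2=S\circ S$, etc. $K((u_1^{\mathbb Z},\dots,u_r^{\mathbb Z}))^{\mathrm{grlex}}$ is the field of generalized series $\sum_{\underline n\in\mathbb Z^r}c_{\underline n}\underline u^{\underline n}$ with $\le_{\mathrm{grlex}}$-well-ordered support, with valuation $w(s)=\min\mathrm{Supp}(s)$, $w(0)=\infty$; the subscript $\mathrm{Mod}$ denotes the subring of series whose exponents are bounded below for the componentwise order, i.e. $\bigcup_{\underline n\in\mathbb Z^r}\underline u^{\underline n}K[[\underline u]]$. For a polynomial $Q=\sum_ja_jy^j$, $w(Q)=\min_jw(a_j)$. A strongly reduced Henselian equation is an equation $y=F(\underline u,y)$ with $F\in K((u_1^{\mathbb Z},\dots,u_r^{\mathbb Z}))^{\mathrm{grlex}}_{\mathrm{Mod}}[y]$, $w(F(\underline u,y))>_{\mathrm{grlex}}\underline0$ and $F(\underline u,0)\not\equiv0$. For $\underline k\in\mathbb N^r$: $z_{\underline k}:=\sum_{\underline n\le_{\mathrm{grlex}}\underline k}c_{\underline n}\underline u^{\underline n}$; $P_{\underline k}(\underline u,y):=P(\underline u,z_{\underline k}+\underline u^{S(\underline k)}y)$;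 $\underline i_{\underline k}:=w(P_{\underline k})$; and one writes $P_{\underline k}(\underline u,y)=\sum_{\underline i\ge_{\mathrm{grlex}}\underline i_{\underline k}}\pi^P_{\underline k,\underline i}(y)\underline u^{\underline i}$ with $\pi^P_{\underline k,\underline i}(y)\in K[y]$. Since $y_0$ is a simple root of $P$ (i.e. $\frac{\partial P}{\partial y}(\underline u,y_0)\ne0$), there is a $\le_{\mathrm{grlex}}$-least multi-index $\underline k_0\in\mathbb N^r$ with $\underline i_{S(\underline k_0)}=\underline i_{\underline k_0}-S(\underline k_0)+S^2(\underline k_0)$; this defines $\underline k_0$. One sets $\omega_0:=(\pi^P_{\underline k_0,\underline i_{\underline k_0}})'(c_{S(\underline k_0)})$, which is the coefficient of the $\le_{\mathrm{grlex}}$-lowest monomial $\underline u^{\underline i_{\underline k_0}-S(\underline k_0)}$ of $\frac{\partial P}{\partial y}(\underline u,y_0)$, hence nonzero. *)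

(* Defs.v *)
From HB Require Import structures.
From mathcomp Require Import all_boot all_order all_algebra.
From mathcomp Require Import boolp classical_sets functions cardinality fsbigop.
From mathcomp Require Import wochoice.

Set Implicit Arguments.
Unset Strict Implicit.
Unset Printing Implicit Defensive.

Import Order.TTheory GRing.Theory Num.Theory.

Local Open Scope classical_set_scope.
Local Open Scope ring_scope.

Definition zvec (r : nat) := {ffun 'I_r -> int}.

HB.instance Definition _ r := GRing.Zmodule.copy (zvec r) {ffun 'I_r -> int}.

Section Grlex.
Variable r : nat.
Implicit Types m n p : zvec r.

Definition zdeg n : int := \sum_(i < r) n i.

(* [codom n] lists n_1, ..., n_r in this order, so the first coordinate is the
   most significant one in the lexicographic comparison. *)
Definition zgr n : seqlexi int := zdeg n :: codom n.

Definition grlex_le m n := (zgr m <= zgr n)%O.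
Definition grlex_lt m n := (zgr m < zgr n)%O.

Lemma zgr_inj : injective zgr.
Proof.
move=> m n [_ e]; apply/ffunP => i.
have /ffunP/(_ i) // : m = n.
by apply/eqP; rewrite -(can_eq fgraphK); apply/eqP/val_inj; rewrite /= -!codom_ffun.
Qed.

Lemma grlex_lt_def m n : grlex_lt m n = (n != m) && grlex_le m n.
Proof. by rewrite /grlex_lt lt_def (inj_eq zgr_inj). Qed.

Lemma grlex_le_refl : reflexive grlex_le.
Proof. by move=> n; apply: lexx. Qed.

Lemma grlex_le_anti : antisymmetric grlex_le.
Proof. by move=> m n h; apply/zgr_inj/le_anti. Qed.

Lemma grlex_le_trans : transitive grlex_le.
Proof. by move=> n m p; apply: le_trans. Qed.

Lemma grlex_le_total : total grlex_le.
Proof. by move=> m n; apply: le_total. Qed.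

End Grlex.

(* The order of [zvec r] is the graded lexicographic one; it carries the display
   of ring_scope, so that [m <= n] and [m < n] below always mean grlex. *)
HB.instance Definition _ r := Order.isPOrder.Build ring_display (zvec r)
  (@grlex_lt_def r) (@grlex_le_refl r) (@grlex_le_anti r) (@grlex_le_trans r).
HB.instance Definition _ r :=
  Order.POrder_isTotal.Build ring_display (zvec r) (@grlex_le_total r).

Section GrlexTheory.
Variable r : nat.
Implicit Types m n p : zvec r.

Lemma seqlexi_addr (I : Type) (s : seq I) (f g h : I -> int) (x y z : int) :
  ((x + z :: map (fun i => f i + h i) s : seqlexi int)
     < (y + z :: map (fun i => g i + h i) s : seqlexi int))%O
  = ((x :: map f s : seqlexi int) < (y :: map g s : seqlexi int))%O.
Proof.
elim: s x y z => [|i s IH] x y z; rewrite ltxi_cons [RHS]ltxi_cons !lerD2r //.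
by congr (_ && (_ ==> _)); apply: IH.
Qed.

Lemma grlex_ltD2r p m n : (m + p < n + p) = (m < n).
Proof.
rewrite /Order.lt /= /grlex_lt /zgr.
have D q : zdeg (q + p) = zdeg q + zdeg p.
  by rewrite /zdeg -big_split; apply: eq_bigr => i _; rewrite ffunE.
have C q : codom (q + p) = map (fun i => q i + p i) (enum 'I_r).
  by rewrite codomE; apply: eq_map => i; rewrite ffunE.
by rewrite !D !C seqlexi_addr -!codomE.
Qed.

Lemma grlex_leD2r p m n : (m + p <= n + p) = (m <= n).
Proof. by rewrite !leNgt grlex_ltD2r. Qed.

Lemma grlex_leD m n p q : m <= n -> p <= q -> m + p <= n + q.
Proof.
move=> mn pq; apply: (@le_trans _ _ (n + p)); first by rewrite grlex_leD2r.
by rewrite ![n + _]addrC grlex_leD2r.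
Qed.

Lemma grlex_leB m n p : (p - m <= p - n) = (n <= m).
Proof.
rewrite -(grlex_leD2r (m + n) (p - m)) addrA subrK [m + n]addrC addrA subrK.
by rewrite ![p + _]addrC grlex_leD2r.
Qed.

End GrlexTheory.

(* Well-ordered subsets of Z^r, and the classical facts which make the product of
   two series with well-ordered supports well defined. *)
Section WellOrdered.
Variable r : nat.
Implicit Types (A B X : set (zvec r)) (m n : zvec r).

Definition wo_set A := forall X, X `<=` A -> X !=set0 ->
  exists2 m, X m & forall n, X n -> m <= n.

Lemma wo_chainP (S : {pred zvec r}) : wo_chain <=%R S <-> wo_set [set` S].
Proof.
split=> [wS X XS [n Xn] | wS].
  have [m [[/asboolP Xm lb] _]] : exists! z, minimum_of <=%R [pred n | `[< X n >]] z.
    apply: wS; first by move=> z /asboolP; apply: XS.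
    by exists n; apply/asboolP.
  by exists m => // k Xk; apply: lb; apply/asboolP.
apply: antisymmetric_wo_chain => [m n _ _ | X XS [n Xn]]; first exact: le_anti.
have [||m Xm lb] := wS [set` X]; [exact: XS | by exists n |].
by exists m; split.
Qed.

Lemma wo_setS A B : A `<=` B -> wo_set B -> wo_set A.
Proof. by move=> AB wB X XA; apply: wB => n /XA /AB. Qed.

Lemma wo_set1 m : wo_set [set m].
Proof. by move=> X Xm [n Xn]; exists n => // k /Xm ->; rewrite (Xm _ Xn). Qed.

Lemma wo_setU A B : wo_set A -> wo_set B -> wo_set (A `|` B).
Proof.
move=> wA wB X XAB [n Xn].
have [|XA0] := pselect ((X `&` A) !=set0); last first.
  by apply: wB; [move=> k Xk; case: (XAB k Xk) => // Ak; case: XA0; exists k | exists n].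
case/(wA _ (@subIsetr _ X A)) => a [Xa Aa] la.
have [|XB0] := pselect ((X `&` B) !=set0); last first.
  by exists a => // k Xk; case: (XAB k Xk) => ?; [apply: la | case: XB0; exists k].
case/(wB _ (@subIsetr _ X B)) => b [Xb Bb] lb.
have [ab|/ltW ba] := leP a b.
  exists a => // k Xk; case: (XAB k Xk) => ?; first exact: la.
  by apply: le_trans ab (lb _ _).
exists b => // k Xk; case: (XAB k Xk) => ?; last exact: lb.
by apply: le_trans ba (la _ _).
Qed.

Lemma wo_ind A (P : zvec r -> Prop) : wo_set A ->
  (forall m, A m -> (forall n, A n -> n < m -> P n) -> P m) ->
  forall m, A m -> P m.
Proof.
move=> wA IH m Am; apply: contrapT => nPm.
have [|m0 [Am0 nP] lb] := wA (A `&` [set n | ~ P n]) (@subIsetl _ _ _).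
  by exists m.
apply: nP; apply: IH => // n An nm; apply: contrapT => nPn.
by have := lb n (conj An nPn); rewrite leNgt nm.
Qed.

Definition sumset A B := [set m + n | m in A & n in B].

Lemma wo_sumset A B : wo_set A -> wo_set B -> wo_set (sumset A B).
Proof.
move=> wA wB X XAB X0.
have first (T : set (zvec r * zvec r)) : T `<=` A `*` B -> T !=set0 ->
    exists2 t, T t & forall s, T s -> s.2 < t.2 \/ t.1 + t.2 <= s.1 + s.2.
  move=> TAB [[x y] Txy].
  have [||a [b Tab] la] := wA [set a | exists b, T (a, b)].
  - by move=> a [b /TAB[]].
  - by exists x, y.
  have [||b' Tab' lb] := wB [set b | T (a, b)]; [by move=> c /TAB[] | by exists b |].
  exists (a, b') => // -[c d] Tcd /=.
  have [|bd] := ltP d b'; [by left | right].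
  by apply: grlex_leD => //; apply: la; exists d.
have bounded y : B y -> forall T : set (zvec r * zvec r),
    T `<=` A `*` B -> T !=set0 -> (forall t, T t -> t.2 < y) ->
    exists2 t, T t & forall s, T s -> t.1 + t.2 <= s.1 + s.2.
  move: y; apply: (wo_ind wB) => y By IH T TAB T0 Ty.
  have [t Tt ft] := first T TAB T0.
  have [ne|e] := pselect ((T `&` [set s | s.2 < t.2]) !=set0); last first.
    exists t => // s Ts; case: (ft s Ts) => // st.
    by case: e; exists s.
  have [||||u [Tu ut] lu] := IH t.2 _ (Ty t Tt) (T `&` [set s | s.2 < t.2]).
  - by case: (TAB t Tt).
  - by move=> s [/TAB].
  - by [].
  - by move=> s [].
  have [tu|/ltW ut'] := leP (t.1 + t.2) (u.1 + u.2).
    exists t => // s Ts; case: (ft s Ts) => // st.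
    by apply: le_trans tu (lu _ _).
  exists u => // s Ts; case: (ft s Ts) => st; first exact: lu.
  exact: le_trans ut' st.
pose T := [set t : zvec r * zvec r | [/\ A t.1, B t.2 & X (t.1 + t.2)]].
have TAB : T `<=` A `*` B by move=> t [].
have T0 : T !=set0.
  by case: X0 => x Xx; case: (XAB x Xx) => a Aa [b Bb e]; exists (a, b); split; rewrite //= e.
have [t Tt ft] := first T TAB T0.
have rep x : X x -> exists2 s, T s & s.1 + s.2 = x.
  by move=> Xx; case: (XAB x Xx) => a Aa [b Bb e]; exists (a, b) => //; split; rewrite //= e.
have [ne|e] := pselect ((T `&` [set s | s.2 < t.2]) !=set0); last first.
  exists (t.1 + t.2); first by case: Tt.
  move=> x /rep[s Ts <-]; case: (ft s Ts) => // st.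
  by case: e; exists s.
have [||||u [Tu ut] lu] := bounded t.2 _ (T `&` [set s | s.2 < t.2]).
- by case: Tt.
- by move=> s [/TAB].
- by [].
- by move=> s [].
have [tu|/ltW ut'] := leP (t.1 + t.2) (u.1 + u.2).
  exists (t.1 + t.2); first by case: Tt.
  move=> x /rep[s Ts <-]; case: (ft s Ts) => // st.
  by apply: le_trans tu (lu _ _).
exists (u.1 + u.2); first by case: Tu.
move=> x /rep[s Ts <-]; case: (ft s Ts) => st; first exact: lu.
exact: le_trans ut' st.
Qed.

Lemma wo_finite A p : wo_set A -> wo_set [set p - n | n in A] -> finite_set A.
Proof.
move=> wA wpA.
have maxA X : X `<=` A -> X !=set0 -> exists2 m, X m & forall n, X n -> n <= m.
  move=> XA [x Xx]; have [||y [m Xm <-] lb] := wpA [set p - n | n in X].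
  - by move=> _ [n /XA An <-]; exists n.
  - by exists (p - x), x.
  by exists m => // n Xn; rewrite -(grlex_leB _ _ p); apply: lb; exists n.
have fin m : A m -> finite_set (A `&` [set n | n < m]).
  move: m; apply: (wo_ind wA) => m Am IH.
  have [ne|e] := pselect ((A `&` [set n | n < m]) !=set0); last first.
    by rewrite (_ : _ `&` _ = set0) // -subset0 => n An; apply: e; exists n.
  have [q [Aq qm] mq] := maxA _ (@subIsetl _ _ _) ne.
  apply: (@sub_finite_set _ _ (q |` (A `&` [set n | n < q]))).
    move=> n An; have := mq n An; rewrite le_eqVlt => /orP[/eqP ->|nq]; first by left.
    by right; split => //; case: An.
  by rewrite finite_setU; split; [exact: finite_set1 | apply: IH].
have [ne|e] := pselect (A !=set0); last first.
  by rewrite (_ : A = set0) // -subset0 => n An; apply: e; exists n.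
have [q Aq mq] := maxA A (fun _ => id) ne.
apply: (@sub_finite_set _ _ (q |` (A `&` [set n | n < q]))).
  move=> n An; have := mq n An; rewrite le_eqVlt => /orP[/eqP ->|nq]; first by left.
  by right; split.
by rewrite finite_setU; split; [exact: finite_set1 | apply: fin].
Qed.

Lemma wo_finite_decomp A B p : wo_set A -> wo_set B ->
  finite_set (A `&` [set n | B (p - n)]).
Proof.
move=> wA wB; apply: (@wo_finite _ p); first exact: wo_setS (@subIsetl _ _ _) wA.
by apply: wo_setS wB => _ [n [_ Bn] <-].
Qed.

End WellOrdered.

(* The series sum_n s_n u^n with grlex-well-ordered support:
   K((u_1^Z, ..., u_r^Z))^grlex. *)
Record hahn (K : fieldType) (r : nat) := Hahn {
  hcoef :> zvec r -> K;
  hcoef_wo : wo_chain <=%R (support hcoef) }.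

HB.instance Definition _ K r := gen_eqMixin (hahn K r).
HB.instance Definition _ K r := gen_choiceMixin (hahn K r).

Section HahnRing.
Variables (K : fieldType) (r : nat).
Implicit Types (s t v : hahn K r) (c : K) (m n p : zvec r).

Definition hsupp s : set (zvec r) := [set n | s n != 0].

Lemma hsupp_wo s : wo_set (hsupp s).
Proof. exact/wo_chainP/hcoef_wo. Qed.

Lemma hahnP s t : (forall n, s n = t n) -> s = t.
Proof.
case: s t => [f wf] [g wg] /= /funext fg; subst g.
by congr Hahn; apply: Prop_irrelevance.
Qed.

Lemma mkhahn_subproof (f : zvec r -> K) :
  wo_set [set n | f n != 0] -> wo_chain <=%R (support f).
Proof. by move=> w; apply/wo_chainP. Qed.

Definition mkhahn f w := Hahn (@mkhahn_subproof f w).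

Lemma hmonom_wo c m : wo_set [set n | (if n == m then c else 0) != 0].
Proof.
apply: wo_setS (wo_set1 (m := m)) => n /=.
by case: (n =P m) => //; rewrite eqxx.
Qed.

(* c u^m *)
Definition hmonom c m : hahn K r := mkhahn (@hmonom_wo c m).

Lemma hadd_wo s t : wo_set [set n | s n + t n != 0].
Proof.
apply: wo_setS (wo_setU (@hsupp_wo s) (@hsupp_wo t)) => n /=.
have [e|] := eqVneq (s n) 0; last by left.
by rewrite e add0r; right.
Qed.

Lemma hopp_wo s : wo_set [set n | - s n != 0].
Proof. by apply: wo_setS (@hsupp_wo s) => n /=; rewrite oppr_eq0. Qed.

Definition hzero : hahn K r := hmonom 0 0.
Definition hone : hahn K r := hmonom 1 0.
Definition hadd s t : hahn K r := mkhahn (@hadd_wo s t).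
Definition hopp s : hahn K r := mkhahn (@hopp_wo s).

Definition hconv s t n : K := \sum_(m \in [set: zvec r]) s m * t (n - m).

Definition hdecomp s t n := hsupp s `&` [set m | hsupp t (n - m)].

Lemma hdecomp_finite s t n : finite_set (hdecomp s t n).
Proof. exact: wo_finite_decomp (@hsupp_wo s) (@hsupp_wo t). Qed.

Lemma hconvE A s t n : hdecomp s t n `<=` A ->
  hconv s t n = \sum_(m \in A) s m * t (n - m).
Proof.
move=> sA; apply/esym/fsbig_widen => // m [_ /= nA].
apply/eqP; apply: contra_notT nA; rewrite mulf_eq0 negb_or => /andP[sm tm].
by apply: sA.
Qed.

Lemma hconv_neq0 s t n : hconv s t n != 0 -> sumset (hsupp s) (hsupp t) n.
Proof.
apply: contraNP => h; apply/eqP/fsbig1 => m _.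
apply/eqP; apply: contra_notT h; rewrite mulf_eq0 negb_or => /andP[sm tm].
by exists m => //; exists (n - m) => //; rewrite addrC subrK.
Qed.

Lemma hmul_wo s t : wo_set [set n | hconv s t n != 0].
Proof.
by apply: wo_setS (wo_sumset (@hsupp_wo s) (@hsupp_wo t)) => n /hconv_neq0.
Qed.

Definition hmul s t : hahn K r := mkhahn (@hmul_wo s t).

Lemma haddA : associative hadd.
Proof. by move=> s t v; apply: hahnP => n /=; rewrite addrA. Qed.

Lemma haddC : commutative hadd.
Proof. by move=> s t; apply: hahnP => n /=; rewrite addrC. Qed.

Lemma hadd0 : left_id hzero hadd.
Proof. by move=> s; apply: hahnP => n /=; rewrite if_same add0r. Qed.

Lemma haddN : left_inverse hzero hopp hadd.
Proof. by move=> s; apply: hahnP => n /=; rewrite if_same addNr. Qed.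

HB.instance Definition _ := GRing.isZmodule.Build (hahn K r) haddA haddC hadd0 haddN.

Lemma hmulC : commutative hmul.
Proof.
move=> s t; apply: hahnP => n /=; rewrite /hconv.
rewrite (reindex_fsbigT (fun m => n - m)) /=; last first.
  by exists (fun m => n - m) => m; rewrite subKr.
by apply: eq_fsbigr => m _; rewrite subKr mulrC.
Qed.

Lemma hmonom_conv c m s n : hconv (hmonom c m) s n = c * s (n - m).
Proof.
rewrite (@hconvE [set m]) ?fsbig_set1 /= ?eqxx // => k [].
by rewrite /hsupp /=; case: (k =P m) => //; rewrite eqxx.
Qed.

Lemma hmul1 : left_id hone hmul.
Proof. by move=> s; apply: hahnP => n /=; rewrite hmonom_conv mul1r subr0. Qed.

Lemma hmulDl : left_distributive hmul hadd.
Proof.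
move=> s t v; apply: hahnP => n /=.
have fA : finite_set (hdecomp s v n `|` hdecomp t v n).
  by rewrite finite_setU; split; apply: hdecomp_finite.
rewrite !(@hconvE (hdecomp s v n `|` hdecomp t v n)).
- rewrite -fsbig_split //; apply: eq_fsbigr => m _ /=; exact: mulrDl.
- by move=> ?; right.
- by move=> ?; left.
move=> m [sm vm]; have [e|] := eqVneq (s m) 0; last by left.
by right; split => //; move: sm; rewrite /hsupp /= e add0r.
Qed.

Lemma hmulA : associative hmul.
Proof.
move=> s t v; apply: hahnP => n /=.
pose A' := hsupp s `&` [set m | sumset (hsupp t) (hsupp v) (n - m)].
pose C' := sumset (hsupp s) (hsupp t) `&` [set m | hsupp v (n - m)].
have fA : finite_set A'.
  exact: wo_finite_decomp (@hsupp_wo s) (wo_sumset (@hsupp_wo t) (@hsupp_wo v)).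
have fC : finite_set C'.
  exact: wo_finite_decomp (wo_sumset (@hsupp_wo s) (@hsupp_wo t)) (@hsupp_wo v).
rewrite (@hconvE A'); last by move=> m [? /hconv_neq0 ?].
rewrite (@hconvE C'); last by move=> m [/hconv_neq0 ? ?].
have R k : C' k -> hconv s t k * v (n - k)
    = \sum_(a \in A') s a * (t (k - a) * v (n - k)).
  move=> [_ vc]; rewrite (@hconvE A'); last first.
    move=> a [sa ta]; split=> //=; exists (k - a) => //; exists (n - k) => //.
    by rewrite addrC addrA subrK.
  rewrite !fsbig_finite // mulr_suml; apply: eq_bigr => a _.
  by rewrite mulrA.
have L a : A' a -> s a * hconv t v (n - a)
    = \sum_(k \in C') s a * (t (k - a) * v (n - k)).
  move=> [sa _].
  rewrite (@hconvE [set k - a | k in C']); last first.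
    move=> b [tb vb]; exists (a + b); last by rewrite [a + b]addrC addrK.
    split; first by exists a => //; exists b.
    by rewrite /= opprD addrA.
  rewrite fsbig_image; last by move=> x y _ _ /addIr.
  rewrite !fsbig_finite // mulr_sumr; apply: eq_bigr => k _.
  by rewrite opprB addrA subrK.
transitivity (\sum_(a \in A') \sum_(k \in C') s a * (t (k - a) * v (n - k))).
  by apply: eq_fsbigr => a /set_mem; exact: L.
rewrite exchange_fsbig //.
by apply: eq_fsbigr => k /set_mem /R.
Qed.

Lemma hone_neq0 : hone != hzero.
Proof.
by apply/eqP => /(congr1 (fun s : hahn K r => s 0)) /eqP; rewrite /= eqxx oner_eq0.
Qed.

HB.instance Definition _ := GRing.Zmodule_isComNzRing.Build (hahn K r)
  hmulA hmulC hmul1 hmulDl hone_neq0.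

Definition hunit : {pred hahn K r} := [pred s | `[< exists t, t * s = 1 >]].
Definition hinv s : hahn K r := if s \in hunit then xget 0 [set t | t * s = 1] else s.

Lemma hmulVs : {in hunit, left_inverse 1 hinv *%R}.
Proof.
move=> s us; rewrite /hinv us; move: us => /asboolP[t ts].
exact: (xgetPex 0 (ex_intro (fun t => t * s = 1) t ts)).
Qed.

Lemma hunitP s t : t * s = 1 -> hunit s.
Proof. by move=> ts; apply/asboolP; exists t. Qed.

Lemma hinv_out : {in [predC hunit], hinv =1 id}.
Proof. by move=> s; rewrite inE /hinv /= => /negbTE ->. Qed.

HB.instance Definition _ := GRing.ComNzRing_hasMulInverse.Build (hahn K r)
  hmulVs hunitP hinv_out.

Lemma hmonomM c d m n : hmonom c m * hmonom d n = hmonom (c * d) (m + n).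
Proof.
apply: hahnP => p; rewrite [LHS]hmonom_conv /= subr_eq [n + m]addrC.
by case: eqP; rewrite ?mulr0.
Qed.

Lemma hmonom_unit c m : c != 0 -> hmonom c m \is a GRing.unit.
Proof.
by move=> c0; apply: (@hunitP _ (hmonom c^-1 (- m))); rewrite hmonomM mulVf ?addNr.
Qed.

Lemma hmonomV c m : c != 0 -> (hmonom c m)^-1 = hmonom c^-1 (- m).
Proof.
move=> c0; apply: (mulIr (hmonom_unit m c0)).
by rewrite mulVr ?hmonom_unit // hmonomM mulVf // addNr.
Qed.

End HahnRing.

(* N^r as a subset of Z^r. *)
Definition natvec {r} : set (zvec r) := [set n | forall i, 0 <= n i].

(* S(k): the successor of k in (N^r, grlex). *)
Definition grlex_succ {r} (k : zvec r) : zvec r :=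
  xget k [set m | [/\ natvec m, k < m & forall n, natvec n -> k < n -> m <= n]].

(* K[[u]] *)
Definition pseries {K r} : {pred hahn K r} :=
  [pred s : hahn K r | `[< forall m, s m != 0 -> natvec m >]].

(* The subring with subscript Mod: exponents bounded below componentwise. *)
Definition modseries {K r} : {pred hahn K r} :=
  [pred s : hahn K r |
    `[< exists n : zvec r, forall m, s m != 0 -> forall i, n i <= m i >]].

(* Values in Z^r + {oo}, with [None] for oo. *)
Section Valuation.
Variable r : nat.
Implicit Types a b : option (zvec r).

Definition wlt a b : bool :=
  match a, b with
  | Some m, Some n => m < n
  | Some _, None => true
  | None, _ => false
  end.

Definition wmin a b := if wlt a b then a else b.

End Valuation.

Definition hval {K r} (s : hahn K r) : option (zvec r) :=
  if s == 0 then None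
  else Some (xget 0 [set m | minimum_of <=%R (support s) m]).

Definition pval {K r} (Q : {poly hahn K r}) : option (zvec r) :=
  \big[@wmin r/None]_(j < size Q) hval Q`_j.

(* y = F(u, y) is a strongly reduced Henselian equation. *)
Definition strongly_reduced_henselian {K r} (F : {poly hahn K r}) : Prop :=
  [/\ F \is a polyOver modseries, wlt (Some 0) (pval F) & F.[0] != 0].

(* s is the sum of the (summable) family g of generalized series. *)
Definition is_hsum {K r} (g : nat -> hahn K r) (s : hahn K r) : Prop :=
  [/\ wo_set (\bigcup_j hsupp (g j)),
      forall n, finite_set [set j | g j n != 0]
    & forall n, s n = \sum_(j \in [set: nat]) g j n].

Section Expansion.
Variables (K : fieldType) (r : nat) (P : {poly hahn K r}) (y0 : hahn K r).
Implicit Type k : zvec r.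

(* z_k; the coefficient c_n of y0 is [y0 n]. *)
Definition zpart k : hahn K r :=
  \sum_(n \in [set n | natvec n /\ n <= k]) hmonom (y0 n) n.

(* P_k(u, y) = P(u, z_k + u^S(k) y) *)
Definition Pk k : {poly hahn K r} :=
  P \Po ((zpart k)%:P + hmonom 1 (grlex_succ k) *: 'X).

(* i_k = w(P_k). For P != 0 one has P_k != 0, so the default 0 is not used. *)
Definition ik k : zvec r := odflt 0 (pval (Pk k)).

(* pi^P_{k,i}(y), the coefficient of u^i in P_k *)
Definition pik k (i : zvec r) : {poly K} := \poly_(j < size (Pk k)) (Pk k)`_j i.

Definition k0_cond : set (zvec r) := [set k | natvec k /\
  ik (grlex_succ k) = ik k - grlex_succ k + grlex_succ (grlex_succ k)].

(* The default 0 matters only if no index satisfies the condition, which does not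
   happen for a simple root y0 of P. *)
Definition k0 : zvec r :=
  xget 0 [set k | k0_cond k /\ forall k', k0_cond k' -> k <= k'].

Definition omega0 : K := (pik k0 (ik k0))^`().[y0 (grlex_succ k0)].

(* P_k(u, y + c_S(k)) / (- omega0 u^i_k); the inverse of a nonzero monomial is
   given by [hmonomV]. *)
Definition Rk k : {poly hahn K r} :=
  (hmonom (- omega0) (ik k))^-1
    *: (Pk k \Po ('X + (hmonom (y0 (grlex_succ k)) 0)%:P)).

(* t_k = (y0 - z_k) / u^k *)
Definition tail k : hahn K r := (y0 - zpart k) / hmonom 1 k.

End Expansion.

(* Main.v *)
Require Import Defs.
From HB Require Import structures.
From mathcomp Require Import all_boot all_order all_algebra.
From mathcomp Require Import boolp classical_sets functions cardinality fsbigop.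
From mathcomp Require Import wochoice.

(* Expand P around its root: P(y0 + h) = sum_(j >= 1) b_j h^j with b_1 = dP/dy (u, y0)
   of value w. With T = (y0 - z_k) / u^S(k), which has nonnegative value,
   P_k(y) = sum_j b_j u^(j S(k)) (y - T)^j, and translating by T does not change the
   Gauss valuation, so i_k is the minimum over j >= 1 of w(b_j) + j S(k). Since S(k)
   grows strictly with k, the equation i_S(k) = i_k - S(k) + S^2(k) says exactly that
   this minimum is reached at j = 1, i.e. w + S(k) <= w(b_j) + j S(k) for all j; this
   persists when k grows, and becomes strict for j >= 2 as soon as k > k_0. Dividing
   by - omega_0 u^(w + S(k)) then leaves -(y - t) plus terms of positive value, where
   t = (y0 - z_S(k)) / u^S(k) has positive value. *)

Set Implicit Arguments.
Unset Strict Implicit.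
Unset Printing Implicit Defensive.

Import Order.TTheory GRing.Theory Num.Theory.

Local Open Scope classical_set_scope.
Local Open Scope ring_scope.

(** * The graded lexicographic order on Z^r, and successors in N^r *)

Section GrlexOrder.
Variable r : nat.
Implicit Types (k m n p q : zvec r) (j : nat).

Lemma grlex_subr_ge0 m n : (0 <= n - m) = (m <= n).
Proof. by rewrite -(grlex_leD2r m 0) add0r subrK. Qed.

Lemma grlex_subr_gt0 m n : (0 < n - m) = (m < n).
Proof. by rewrite -(grlex_ltD2r m 0) add0r subrK. Qed.

Lemma grlex_leD2l p m n : (p + m <= p + n) = (m <= n).
Proof. by rewrite ![p + _]addrC grlex_leD2r. Qed.

Lemma grlex_leBlDr p m n : (m - p <= n) = (m <= n + p).
Proof. by rewrite -(grlex_leD2r p (m - p)) subrK. Qed.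

Lemma grlex_ltD m n p q : m < n -> p <= q -> m + p < n + q.
Proof.
move=> mn pq; apply: (@lt_le_trans _ _ (n + p)); first by rewrite grlex_ltD2r.
by rewrite grlex_leD2l.
Qed.

Lemma grlex_mulrn j p q : p <= q -> p *+ j <= q *+ j.
Proof. by move=> pq; elim: j => // j IH; rewrite !mulrS grlex_leD. Qed.

Lemma grlex_mulrn_lt j p q : p < q -> p *+ j.+1 < q *+ j.+1.
Proof.
by move=> pq; rewrite !mulrS; apply: grlex_ltD => //; apply/grlex_mulrn/ltW.
Qed.

Lemma zdeg_lt m n : zdeg m < zdeg n -> m < n.
Proof. by move=> h; rewrite /Order.lt /= /grlex_lt ltxi_cons (ltW h) leNgt h. Qed.

Lemma zdeg_le m n : m <= n -> zdeg m <= zdeg n.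
Proof. by rewrite leNgt [in X in _ -> X]leNgt; apply/contra/zdeg_lt. Qed.

Lemma natvec0 : natvec (0 : zvec r).
Proof. by move=> i; rewrite ffunE. Qed.

Lemma natvecD m n : natvec m -> natvec n -> natvec (m + n).
Proof. by move=> hm hn i; rewrite ffunE addr_ge0. Qed.

(** A vector of N^r below 0 would have degree 0, and nonnegative coordinates with zero sum all
    vanish. *)
Lemma natvec_ge0 n : natvec n -> 0 <= n.
Proof.
move=> hn; rewrite leNgt; apply/negP => n0.
have s0 : zdeg n == 0.
  rewrite eq_le sumr_ge0 ?andbT => [|i _]; last exact: hn.
  by have := zdeg_le (ltW n0); rewrite {2}/zdeg big1 // => i _; rewrite ffunE.
suff e : n = 0 by rewrite e ltxx in n0.
apply/ffunP => i; rewrite ffunE.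
by move: s0; rewrite psumr_eq0 => [/allP/(_ i (mem_index_enum _))/eqP|j _].
Qed.

(** On N^r the degree bounds every coordinate, so these vectors fit in a finite box. *)
Lemma finite_natvec_le p : finite_set [set n | natvec n /\ n <= p].
Proof.
pose f (g : {ffun 'I_r -> 'I_`|zdeg p|.+1}) : zvec r := [ffun i => (g i : nat)%:Z].
apply: (@sub_finite_set _ _ (f @` setT)); last exact/finite_image/finite_finset.
move=> n [hn np]; exists [ffun i => inord `|n i|] => //.
apply/ffunP => i; rewrite !ffunE inordK; first by rewrite gez0_abs.
rewrite ltnS -lez_nat gez0_abs; last exact: hn.
apply: le_trans (lez_abs _); apply: le_trans (zdeg_le np).
by rewrite /zdeg (bigD1 i) //= lerDl sumr_ge0.
Qed.

Lemma finite_wo (A : set (zvec r)) : finite_set A -> wo_set A.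
Proof.
case/finite_seqP => s ->; elim: s => [|x s IH]; first by move=> X Xs [n /Xs].
apply: wo_setS (wo_setU (@wo_set1 _ x) IH) => n.
by rewrite /= inE => /orP[/eqP ->|]; [left|right].
Qed.

Lemma wo_natvec : wo_set (@natvec r).
Proof.
move=> X Xn [x Xx].
have [||m [Xm mx] lb] :=
    finite_wo (finite_natvec_le x) (X := X `&` [set n | n <= x]).
- by move=> n [/Xn].
- by exists x; split => /=.
exists m => // n Xn'; have [nx|/ltW xn] := leP n x; first exact: lb.
exact: le_trans xn.
Qed.

Hypothesis r_gt0 : (0 < r)%N.

Lemma natvec_large (N : nat) : exists2 n : zvec r, natvec n & N%:Z <= zdeg n.
Proof.
exists [ffun => N%:Z]; first by move=> i; rewrite ffunE.
rewrite /zdeg; under eq_bigr do rewrite ffunE.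
by rewrite sumr_const card_ord -mulr_natl ler_peMl // ler1n.
Qed.

(** Since r > 0, N^r has vectors of arbitrarily large degree, so the default of [grlex_succ] is
    never returned. Here [k] may be any vector of Z^r. *)
Lemma grlex_succP (k : zvec r) : natvec (grlex_succ k) /\ k < grlex_succ k /\
  forall n, natvec n -> k < n -> grlex_succ k <= n.
Proof.
suff [m Sm] : exists m, [set m | [/\ natvec m, k < m
    & forall n, natvec n -> k < n -> m <= n]] m.
  by have [] := xgetPex k (ex_intro _ m Sm).
have [||m [hm km] lb] := wo_natvec (X := natvec `&` [set n | k < n]).
- by move=> n [].
- have [n hn Nn] := natvec_large `|zdeg k|.+1; exists n; split=> //.
  by apply: zdeg_lt; apply: lt_le_trans Nn; apply: le_lt_trans (lez_abs _) _; rewrite ltz_nat.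
by exists m; split=> // n hn kn; apply: lb.
Qed.

Lemma natvec_succ k : natvec (grlex_succ k).
Proof. by case: (grlex_succP k). Qed.

Lemma lt_grlex_succ k : k < grlex_succ k.
Proof. by case: (grlex_succP k) => _ []. Qed.

Lemma grlex_succ_le k n : natvec n -> (grlex_succ k <= n) = (k < n).
Proof.
move=> hn; apply/idP/idP => [|kn]; first exact/lt_le_trans/lt_grlex_succ.
by case: (grlex_succP k) => _ [_]; apply.
Qed.

Lemma lt_iter_grlex_succ k i j : (i < j)%N ->
  iter i grlex_succ k < iter j grlex_succ k.
Proof.
elim: j => // j IH; rewrite ltnS leq_eqVlt => /orP[/eqP ->|/IH ij].
  exact: lt_grlex_succ.
exact: lt_trans ij (lt_grlex_succ _).
Qed.

Lemma iter_grlex_succ_inj k : injective (fun j => iter j grlex_succ k).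
Proof.
move=> i j /= e; case: (ltngtP i j) => // /lt_iter_grlex_succ => /(_ k);
by rewrite e ltxx.
Qed.

Lemma grlex_succ_exhausts k n : natvec n -> k < n ->
  exists j, n = iter j.+1 grlex_succ k.
Proof.
move=> hn kn; apply: contrapT => nex.
have lt j : iter j grlex_succ k < n.
  elim: j => // j IH; rewrite lt_neqAle grlex_succ_le // IH andbT.
  by apply/eqP => e; apply: nex; exists j.
(* The iterates are distinct and all bounded by [n]. They are counted from [j.+1] because [k] itself
   need not lie in N^r. *)
have /infinite_nat [] : finite_set [set: nat].
rewrite -[setT](preimage_setT (fun j => iter j grlex_succ k)).
rewrite (_ : _ @^-1` _ = (fun j => iter j.+1 grlex_succ k) @^-1` [set m | natvec m /\ m <= n]).
  apply: finite_preimage (finite_natvec_le n) => i j _ _ /iter_grlex_succ_inj.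
  by case.
apply/seteqP; split=> // j _; split; first exact: natvec_succ.
exact/ltW/lt.
Qed.

End GrlexOrder.

(** * Composition of polynomials with coefficients in a module over a semiring *)

Section PolyIdeal.
Variables (R : comNzRingType) (S : addrClosed R) (T : semiringClosed R).
Hypothesis SM : forall a b, a \in S -> b \in T -> a * b \in S.

(** Q(G) is the sum of the Q_j G^j, and the powers of G keep their coefficients in [T]. It serves
    with [T] the valuation ring and [S] the series of value at least, or above, a given i. *)
Lemma polyOver_comp_ideal (Q G : {poly R}) :
  Q \is a polyOver S -> G \is a polyOver T -> Q \Po G \is a polyOver S.
Proof.
move=> /polyOverP hQ hG; rewrite comp_polyE; apply: rpred_sum => j _.
have /polyOverP hGj : G ^+ j \is a polyOver T by apply: rpredX.
by apply/polyOverP => l; rewrite coefZ SM.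
Qed.

End PolyIdeal.

Lemma coef_comp_scaleX (R : comNzRingType) (Q : {poly R}) (a : R) j :
  (Q \Po (a *: 'X))`_j = Q`_j * a ^+ j.
Proof.
rewrite coef_comp_poly; under eq_bigr do rewrite exprZn coefZ coefXn.
have [jQ|Qj] := ltnP j (size Q).
  rewrite (bigD1 (Ordinal jQ)) //= eqxx mulr1 big1 ?addr0 // => i.
  by rewrite -val_eqE /= eq_sym => /negbTE ->; rewrite !mulr0.
rewrite nth_default // mul0r big1 // => i _.
by rewrite gtn_eqF ?mulr0 // (leq_trans _ Qj).
Qed.

(** * Supports and values of generalized series, and the Gauss valuation of polynomials *)

Section HahnValuation.
Variables (K : fieldType) (r : nat).
Implicit Types (s t : hahn K r) (A B C : set (zvec r)) (m n i : zvec r).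
Implicit Types (Q : {poly hahn K r}).

Lemma hcoef0 n : (0 : hahn K r) n = 0.
Proof. by rewrite /= if_same. Qed.

Lemma hcoefD s t n : (s + t) n = s n + t n. Proof. by []. Qed.

Lemma hcoefN s n : (- s) n = - s n. Proof. by []. Qed.

Lemma hcoef_sum (I : Type) (l : seq I) (p : pred I) (F : I -> hahn K r) n :
  (\sum_(x <- l | p x) F x) n = \sum_(x <- l | p x) F x n.
Proof.
by elim/big_rec2: _ => [|x ? ? _ <-]; rewrite ?hcoef0 ?hcoefD.
Qed.

Lemma hcoef_monomM c m s n : (hmonom c m * s) n = c * s (n - m).
Proof. exact: hmonom_conv. Qed.

Lemma hmonomX m j : hmonom 1 m ^+ j = hmonom 1 (m *+ j) :> hahn K r.
Proof. by elim: j => // j IH; rewrite exprS IH hmonomM mulr1 mulrS. Qed.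

(** Power series, the valuation ring and its modules [vge] and [vgt] are all support conditions of
    this form, so additive closure is proved once. *)
Definition supp_in A : {pred hahn K r} := [pred s | `[< hsupp s `<=` A >]].

Lemma supp_inP A s : reflect (forall n, s n != 0 -> A n) (s \in supp_in A).
Proof. exact: asboolP. Qed.

Lemma supp_in_zmod A : zmod_closed (supp_in A).
Proof.
split=> [|s t /supp_inP sA /supp_inP tA]; apply/supp_inP => n.
  by rewrite hcoef0 eqxx.
rewrite hcoefD hcoefN; have [->|/sA //] := eqVneq (s n) 0.
by rewrite add0r oppr_eq0; apply: tA.
Qed.

HB.instance Definition _ A :=
  GRing.isZmodClosed.Build (hahn K r) (supp_in A) (supp_in_zmod A).

Lemma supp_inM A B C s t : (forall m n, A m -> B n -> C (m + n)) ->
  s \in supp_in A -> t \in supp_in B -> s * t \in supp_in C.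
Proof.
move=> ABC /supp_inP sA /supp_inP tB; apply/supp_inP => n /hconv_neq0.
by move=> [a /sA Aa [b /tB Bb <-]]; apply: ABC.
Qed.

Lemma supp_in_monom A c m : A m -> hmonom c m \in supp_in A.
Proof. by move=> Am; apply/supp_inP => n /=; case: (n =P m) => [->|_] //; rewrite eqxx. Qed.

Lemma pseriesE : pseries = supp_in (@natvec r).
Proof. by []. Qed.

Lemma pseries_subring : subring_closed (@pseries K r).
Proof.
rewrite pseriesE; split; first exact/supp_in_monom/natvec0.
  exact: (supp_in_zmod _).2.
by move=> s t; apply/supp_inM/natvecD.
Qed.

HB.instance Definition _ :=
  GRing.isSubringClosed.Build (hahn K r) (@pseries K r) pseries_subring.

(** The valuation ring of w. *)
Definition vring : {pred hahn K r} := supp_in [set n | 0 <= n].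

Lemma vring_subring : subring_closed vring.
Proof.
split; [by apply: supp_in_monom; exact: lexx | exact: (supp_in_zmod _).2 | move=> s t].
apply: supp_inM => m n /= m0 n0.
by rewrite -(add0r (0 : zvec r)) grlex_leD.
Qed.

HB.instance Definition _ :=
  GRing.isSubringClosed.Build (hahn K r) vring vring_subring.

Definition vge i := supp_in [set n | i <= n].
Definition vgt i := supp_in [set n | i < n].

Lemma vgeM i s t : s \in vge i -> t \in vring -> s * t \in vge i.
Proof.
by apply: supp_inM => m n /= im n0; rewrite -(addr0 i) grlex_leD.
Qed.

Lemma vgtM i s t : s \in vgt i -> t \in vring -> s * t \in vgt i.
Proof.
by apply: supp_inM => m n /= im n0; rewrite -(addr0 i) grlex_ltD.
Qed.

Lemma polyOver_vge_comp i Q (G : {poly hahn K r}) :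
  Q \is a polyOver (vge i) -> G \is a polyOver vring ->
  Q \Po G \is a polyOver (vge i).
Proof. by apply: polyOver_comp_ideal => s t; apply: vgeM. Qed.

Lemma polyOver_vgt_comp i Q (G : {poly hahn K r}) :
  Q \is a polyOver (vgt i) -> G \is a polyOver vring ->
  Q \Po G \is a polyOver (vgt i).
Proof. by apply: polyOver_comp_ideal => s t; apply: vgtM. Qed.

(** Exponents at least i and at least 0 add up to i only as i + 0, so a single term of the
    convolution survives. *)
Lemma hcoefM_lowest i s t : s \in vge i -> t \in vring -> (s * t) i = s i * t 0.
Proof.
move=> /supp_inP si /supp_inP t0; rewrite [LHS](@hconvE _ _ [set i]).
  by rewrite fsbig_set1 subrr.
move=> m [/si /= im /t0 /=]; rewrite grlex_subr_ge0 => mi.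
by apply/le_anti; rewrite im mi.
Qed.

Lemma hcoefX0 t j : t \in vring -> (t ^+ j) 0 = t 0 ^+ j.
Proof.
move=> ht; elim: j => [|j IH]; first by rewrite !expr0 /= eqxx.
by rewrite !exprS hcoefM_lowest ?IH // rpredX.
Qed.

(** The shape of [pik], for an arbitrary polynomial. When all coefficients have value at least i, it
    is the residue of Q / u^i. *)
Definition lowest_poly Q i : {poly K} := \poly_(j < size Q) Q`_j i.

Lemma coef_lowest_poly Q i j : (lowest_poly Q i)`_j = Q`_j i.
Proof. by rewrite coef_poly; case: ltnP => // /(nth_default 0) ->; rewrite hcoef0. Qed.

Lemma deriv_lowest_poly Q i : (lowest_poly Q i)^`() = lowest_poly Q^`() i.
Proof.
apply/polyP => j; rewrite coef_deriv !coef_lowest_poly coef_deriv.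
by move: Q`_j.+1 => q; elim: j.+1 => [|l IH]; rewrite ?mulr0n ?hcoef0 // !mulrS hcoefD IH.
Qed.

Lemma horner_lowest_poly Q i t : Q \is a polyOver (vge i) -> t \in vring ->
  (lowest_poly Q i).[t 0] = Q.[t] i.
Proof.
move=> /polyOverP hQ ht; rewrite [in RHS]horner_coef hcoef_sum.
rewrite (@horner_coef_wide _ (size Q)) ?size_poly //.
apply: eq_bigr => j _; rewrite coef_lowest_poly hcoefM_lowest ?rpredX //.
by rewrite hcoefX0.
Qed.

Lemma hval_spec s : match hval s with
  | None => s = 0
  | Some m => s m != 0 /\ forall n, s n != 0 -> m <= n end.
Proof.
rewrite /hval; case: eqP => // s0.
have s_ne : hsupp s !=set0.
  apply: contrapT => h; apply: s0; apply: hahnP => n; rewrite hcoef0.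
  by apply: contrapT => /eqP sn; apply: h; exists n.
have [m sm lb] := hsupp_wo (fun _ => id) s_ne.
have [|h1 h2] := xgetPex 0 (_ : [set m | minimum_of <=%R (support s) m] !=set0).
  by exists m.
by split=> // n; apply: h2.
Qed.

Lemma big_wmin_spec (l : seq nat) (F : nat -> hahn K r) :
  match \big[@wmin r/None]_(j <- l) hval (F j) with
  | None => forall j, j \in l -> F j = 0
  | Some m => (forall j n, j \in l -> F j n != 0 -> m <= n)
              /\ exists j, F j m != 0 end.
Proof.
elim: l => [|x l IH]; first by rewrite big_nil.
rewrite big_cons; have := hval_spec (F x); case: (hval _) => [a [Fa a_le]|Fx0].
  move: IH; case: (\big[_/_]_(_ <- _) _) => [b [b_le Fb]|F0]; last first.
    split; last by exists x.
    move=> j n; rewrite inE => /orP[/eqP -> /a_le //|/F0 ->].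
    by rewrite hcoef0 eqxx.
  rewrite /wmin /=; case: ltP => ab; last first.
    split=> // j n; rewrite inE => /orP[/eqP -> /a_le|]; last exact: b_le.
    exact: le_trans.
  split; last by exists x.
  move=> j n; rewrite inE => /orP[/eqP -> /a_le //|jl Fn].
  exact: le_trans (ltW ab) (b_le _ _ jl Fn).
move: IH; rewrite /wmin; case: (\big[_/_]_(_ <- _) _) => [b [b_le Fb]|F0] /=.
  split=> // j n; rewrite inE => /orP[/eqP ->|]; last exact: b_le.
  by rewrite Fx0 hcoef0 eqxx.
by move=> j; rewrite inE => /orP[/eqP ->|/F0].
Qed.

Lemma pval_spec Q : match pval Q with
  | None => Q = 0
  | Some m => Q \is a polyOver (vge m) /\ exists j, Q`_j m != 0 end.
Proof.
rewrite /pval -(big_mkord predT (fun j => hval Q`_j)).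
have := big_wmin_spec (index_iota 0 (size Q)) (fun j => Q`_j).
have Q_out j : j \notin index_iota 0 (size Q) -> Q`_j = 0.
  by rewrite mem_index_iota -leqNgt => /(nth_default 0).
case: (\big[_/_]_(_ <- _) _) => [m [m_le ex]|Q0]; last first.
  apply/polyP => j; rewrite coef0.
  by have [/Q0|/Q_out] := boolP (j \in index_iota 0 (size Q)).
split=> //; apply/polyOverP => j; apply/supp_inP => n.
have [/m_le|/Q_out ->] := boolP (j \in index_iota 0 (size Q)); first exact.
by rewrite hcoef0 eqxx.
Qed.

Lemma pval_eq Q i : Q \is a polyOver (vge i) -> (exists j, Q`_j i != 0) ->
  pval Q = Some i.
Proof.
move=> /polyOverP hQ [j Qj]; have := pval_spec Q.
case: (pval Q) => [m|e]; last by rewrite e coef0 hcoef0 eqxx in Qj.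
move=> [/polyOverP hm [l Ql]]; congr Some; apply/le_anti.
by rewrite (supp_inP _ _ (hQ l)) // (supp_inP _ _ (hm j)).
Qed.

Lemma polyOver_XD s : s \in vring -> 'X + s%:P \is a polyOver vring.
Proof. by move=> hs; rewrite rpredD ?polyOverX ?polyOverC. Qed.

(** Translation by an element of the valuation ring cannot lower the value; if it raised it,
    translating back would put Q itself above i. *)
Lemma pval_shift Q t i : t \in vring -> pval Q = Some i ->
  pval (Q \Po ('X + t%:P)) = Some i.
Proof.
move=> ht Qi; have := pval_spec Q; rewrite Qi => -[hQ [j Qj]].
have hQ' := polyOver_vge_comp hQ (polyOver_XD ht).
apply: (pval_eq hQ'); apply: contrapT => nex.
suff /polyOverP/(_ j)/supp_inP/(_ _ Qj) : Q \is a polyOver (vgt i).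
  by rewrite /= ltxx.
have -> : Q = (Q \Po ('X + t%:P)) \Po ('X - t%:P).
  by rewrite -comp_polyA comp_polyD comp_polyX comp_polyC subrK comp_polyXr.
apply: polyOver_vgt_comp; last by rewrite -polyCN polyOver_XD ?rpredN.
apply/polyOverP => l; apply/supp_inP => n Qn.
rewrite /= lt_neqAle (supp_inP _ _ (polyOverP hQ' l) n Qn) andbT.
by apply/eqP => e; apply: nex; exists l; rewrite e.
Qed.

Lemma wlt_pval Q i : Q \is a polyOver (vgt i) -> wlt (Some i) (pval Q).
Proof.
move=> /polyOverP hQ; have := pval_spec Q.
by case: (pval Q) => // m [_ [j /(supp_inP _ _ (hQ j))]].
Qed.

Lemma modseriesM_monom c m s : s \in pseries -> hmonom c m * s \in modseries.
Proof.
move=> /asboolP hs; apply/asboolP; exists m => n.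
rewrite hcoef_monomM mulf_eq0 negb_or => /andP[_ /hs h] i.
by have := h i; rewrite !ffunE subr_ge0.
Qed.

Lemma modseries_zmod : zmod_closed (@modseries K r).
Proof.
split=> [|s t /asboolP[a sa] /asboolP[b tb]]; apply/asboolP.
  by exists 0 => m; rewrite hcoef0 eqxx.
exists [ffun i => Num.min (a i) (b i)] => m; rewrite hcoefD hcoefN => h i.
rewrite ffunE ge_min; have [e|/sa-> //] := eqVneq (s m) 0.
by rewrite tb ?orbT //; move: h; rewrite e add0r oppr_eq0.
Qed.

HB.instance Definition _ :=
  GRing.isZmodClosed.Build (hahn K r) (@modseries K r) modseries_zmod.

End HahnValuation.

Arguments vring {K r}.

(** * Truncations and tails of y_0, and the Taylor expansion of P at y_0 *)

Section Expansion.
Variables (K : fieldType) (r : nat) (P : {poly hahn K r}) (y0 : hahn K r).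
Hypothesis r_gt0 : (0 < r)%N.
Hypothesis y0_series : y0 \in pseries.
Implicit Types (k m n : zvec r) (j : nat).

Local Notation S k := (grlex_succ k).
(** The y at which z_k + u^S(k) y equals y_0. The divisor is u^S(k), whereas [tail y0 k] divides by
    u^k. *)
Local Notation T k := ((y0 - zpart y0 k) / hmonom 1 (S k)).

Lemma y0_natvec n : y0 n != 0 -> natvec n.
Proof. by have /asboolP := y0_series; apply. Qed.

Lemma hcoef_zpart k n : zpart y0 k n = if n <= k then y0 n else 0.
Proof.
rewrite /zpart fsbig_finite ?hcoef_sum; last exact: finite_natvec_le.
rewrite -fsbig_finite /=; last exact: finite_natvec_le.
(* Outside N^r both sides vanish since y_0 is a power series, so the test [n <= k] suffices. *)
have [nN|nN] := pselect (natvec n); last first.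
  have -> : y0 n = 0 by apply: contrapT => /eqP/y0_natvec.
  rewrite if_same fsbig1 // => m [mN _].
  by case: eqP => // e; case: nN; rewrite e.
case: ifPn => nk; last first.
  by rewrite fsbig1 // => m [_ mk]; case: eqP => // e; rewrite e mk in nk.
rewrite -(fsbig_widen [set n]) ?fsbig_set1 ?eqxx //; first by move=> _ ->.
by move=> m [_ /= mn] /=; rewrite eq_sym; case: eqP.
Qed.

Lemma zpart_series k : zpart y0 k \in pseries.
Proof.
rewrite pseriesE; apply/supp_inP => n; rewrite hcoef_zpart.
by case: ifP => _; [exact: y0_natvec | rewrite eqxx].
Qed.

Lemma hcoef_tail k n : (y0 - zpart y0 k) n = if n <= k then 0 else y0 n.
Proof. by rewrite hcoefD hcoefN hcoef_zpart; case: ifP; rewrite ?subrr ?subr0. Qed.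

Lemma zpart_succ k : zpart y0 (S k) = zpart y0 k + hmonom (y0 (S k)) (S k).
Proof.
apply: hahnP => n; rewrite hcoefD !hcoef_zpart /=.
have [->|nS] := eqVneq n (S k).
  by rewrite lexx leNgt lt_grlex_succ // add0r.
rewrite addr0; have [nN|nN] := pselect (natvec n); last first.
  have -> : y0 n = 0 by apply: contrapT => /eqP/y0_natvec.
  by rewrite !if_same.
by rewrite le_eqVlt (negbTE nS) ltNge grlex_succ_le // -leNgt.
Qed.

Lemma divr_hmonom (s : hahn K r) m n : (s / hmonom 1 m) n = s (n + m).
Proof. by rewrite hmonomV ?oner_neq0 // invr1 mulrC hcoef_monomM mul1r opprK. Qed.

Lemma divr_hmonomK (s : hahn K r) m : s / hmonom 1 m * hmonom 1 m = s.
Proof. by rewrite divrK // hmonom_unit // oner_neq0. Qed.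

(** An exponent of y_0 above k lies in N^r, hence is at least S(k). *)
Lemma shifted_tail_vring k : T k \in vring.
Proof.
apply/supp_inP => n; rewrite divr_hmonom hcoef_tail.
case: leP => [_|kn /y0_natvec nN]; first by rewrite eqxx.
by rewrite /= -(grlex_leD2r (S k) 0) add0r grlex_succ_le.
Qed.

Lemma hcoef_shifted_tail0 k : T k 0 = y0 (S k).
Proof. by rewrite divr_hmonom add0r hcoef_tail leNgt lt_grlex_succ. Qed.

Lemma tail_vgt k : tail y0 k \in vgt 0.
Proof.
apply/supp_inP => n; rewrite divr_hmonom hcoef_tail.
case: leP => [_|kn _]; first by rewrite eqxx.
by rewrite /= -(grlex_ltD2r k 0) add0r.
Qed.

Lemma shifted_tail_succ k : T k = tail y0 (S k) + hmonom (y0 (S k)) 0.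
Proof.
rewrite /tail zpart_succ opprD addrA [(_ - _ - _) / _]mulrBl hmonomV ?oner_neq0 // invr1.
by rewrite hmonomM mulr1 subrr subrK.
Qed.

(** The iterated successors are distinct and exhaust the part of N^r above k, so each exponent
    receives at most one term; all supports stay in N^r - k. *)
Lemma tail_hsum k :
  is_hsum (fun j => hmonom (y0 (iter j.+1 grlex_succ k)) (iter j.+1 grlex_succ k - k))
          (tail y0 k).
Proof.
pose e j := iter j.+1 grlex_succ k.
have gP j n : hmonom (y0 (e j)) (e j - k) n != 0 -> e j = n + k.
  by move=> /=; case: (n =P _) => [->|]; rewrite ?eqxx ?subrK.
have e_inj : injective e by move=> i j /iter_grlex_succ_inj-/(_ r_gt0)[].
have e_gt j : k < e j by apply: (@lt_iter_grlex_succ _ r_gt0 k 0 j.+1).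
split=> [|n|n].
- apply: (@wo_setS _ _ (sumset (@natvec r) [set - k])).
    move=> n [j _ /gP ej]; exists (n + k); last by exists (- k) => //; rewrite addrK.
    by rewrite -ej; apply: natvec_succ.
  by apply: wo_sumset; [exact: wo_natvec | exact: wo_set1].
- have [[j ej]|nex] := pselect (exists j, e j = n + k).
    apply: sub_finite_set (finite_set1 j) => i /gP; rewrite -ej; exact: e_inj.
  apply: sub_finite_set (finite_set0 nat) => i /gP ei; case: nex; by exists i.
- rewrite divr_hmonom hcoef_tail.
  have [[j ej]|nex] := pselect (exists j, e j = n + k).
    rewrite -(fsbig_widen [set j]) ?fsbig_set1 //=; last first.
      move=> i [_ /= ij]; apply: contrapT => /eqP/gP; rewrite -ej => /e_inj.
      exact: ij.
    by rewrite -ej leNgt e_gt -[n](addrK k) -ej eqxx.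
  rewrite fsbig1; last first.
    by move=> j _; apply: contrapT => /eqP/gP ej; apply: nex; exists j.
  case: leP => // kn; apply: contrapT => /eqP/y0_natvec nN; apply: nex.
  by have [j ej] := grlex_succ_exhausts r_gt0 nN kn; exists j.
Qed.

(* The coefficients of b are the b_j = P^(j)(y0) / j! of the Taylor expansion of P
   at y0, so those of B k are the b_j u^(j S(k)). *)
Local Notation b := (P \Po ('X + y0%:P)).
Local Notation B k := (b \Po (hmonom 1 (S k) *: 'X)).

Lemma coef_B k j n : (B k)`_j n = b`_j (n - S k *+ j).
Proof. by rewrite coef_comp_scaleX hmonomX mulrC hcoef_monomM mul1r. Qed.

(** This rests on z_k + u^S(k) y = y_0 + u^S(k) (y - T). *)
Lemma PkE k : Pk P y0 k = B k \Po ('X - (T k)%:P).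
Proof.
rewrite /Pk -!comp_polyA; congr (_ \Po _).
rewrite !(comp_polyD, comp_polyZ, comp_polyX, comp_polyC) scalerBr.
rewrite -[_ *: (T k)%:P]mul_polyC -polyCM mulrC divr_hmonomK polyCB opprB.
by rewrite -addrA subrK addrC.
Qed.

Hypothesis P'_y0 : P^`().[y0] != 0.

Lemma coef_b1 : b`_1 = P^`().[y0].
Proof.
have := coef_deriv b 0; rewrite mulr1n => <-.
rewrite -horner_coef0 deriv_comp derivD derivX derivC addr0 mulr1.
by rewrite horner_comp hornerD hornerX hornerC add0r.
Qed.

(** By [PkE] and [pval_shift], i_k can be read off [B k], which is nonzero because b_1 is; so the
    default in [ik] is not returned. *)
Lemma ik_spec k : (forall j n, b`_j n != 0 -> ik P y0 k <= n + S k *+ j) /\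
  exists j n, b`_j n != 0 /\ ik P y0 k = n + S k *+ j.
Proof.
rewrite /ik PkE; have := pval_spec (B k).
case E : (pval (B k)) => [i|]; last first.
  move=> B0; case/eqP: P'_y0; rewrite -coef_b1; apply: hahnP => n.
  by rewrite -(addrK (S k *+ 1) n) -coef_B B0 coef0 !hcoef0.
move=> [/polyOverP B_ge [j Bi]].
rewrite -polyCN (pval_shift _ E) ?rpredN ?shifted_tail_vring //=; split=> [l n bn|].
  by apply: (supp_inP _ _ (B_ge l)); rewrite coef_B addrK.
by exists j, (i - S k *+ j); rewrite -coef_B subrK.
Qed.

Hypothesis P_y0 : P.[y0] = 0.

Lemma coef_b0 : b`_0 = 0.
Proof. by rewrite -horner_coef0 horner_comp hornerD hornerX hornerC add0r. Qed.

(** * The value w of dP/dy (u, y_0), the index k_0 and the coefficient omega_0 *)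

Variable w : zvec r.
Hypothesis b1_w : b`_1 w != 0.
Hypothesis b1_ge : forall n, b`_1 n != 0 -> w <= n.

(* In P_k, expanded in powers of y - (y0 - z_k) / u^S(k), no term has value below
   that of the linear one, w = w(dP/dy (u, y0)). *)
Definition linear_dominates k :=
  forall j n, b`_j n != 0 -> w + S k <= n + S k *+ j.

(** The exponent w + S(k) always occurs, at j = 1, so the minimum i_k equals it exactly when nothing
    lies below it. *)
Lemma ik_linear_dominates k : linear_dominates k <-> ik P y0 k = w + S k.
Proof.
have [lb [j [n [bn e]]]] := ik_spec k; split=> [dom|e' j' n' /lb]; last by rewrite e'.
by apply/le_anti; rewrite {2}e dom // -{1}(mulr1n (S k)) lb.
Qed.

(** After cancelling one S(k), dominance reads w <= n + (j+1) S(k), whose right side grows strictly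
    with k. *)
Lemma linear_dominates_lt k l : natvec l -> k < l -> linear_dominates k ->
  forall j n, b`_j.+2 n != 0 -> w + S l < n + S l *+ j.+2.
Proof.
move=> natvec_l kl dom j n /dom.
have kl' : S k < S l.
  by apply: le_lt_trans (lt_grlex_succ r_gt0 l); rewrite grlex_succ_le.
rewrite ![_ *+ j.+2]mulrSr !addrA grlex_leD2r grlex_ltD2r => /le_lt_trans; apply.
by rewrite ![n + _]addrC; apply: grlex_ltD => //; apply: grlex_mulrn_lt.
Qed.

Lemma linear_dominates_succ k : natvec k ->
  linear_dominates k -> linear_dominates (S k).
Proof.
move=> k_nat dom [|[|j]] n bn.
- by rewrite coef_b0 hcoef0 eqxx in bn.
- by rewrite mulr1n grlex_leD2r b1_ge.
- apply/ltW; apply: (linear_dominates_lt _ _ dom) => //; last exact: lt_grlex_succ.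
  exact: natvec_succ.
Qed.

Lemma k0_condE k : k0_cond P y0 k <-> natvec k /\ linear_dominates k.
Proof.
split=> -[k_nat]; last first.
  move=> dom; split=> //; have := linear_dominates_succ k_nat dom.
  move/ik_linear_dominates: dom => ->; move/ik_linear_dominates => ->.
  by rewrite addrK.
move=> e; split=> //.
have [lb _] := ik_spec k.
have [_ [j [n [bn e']]]] := ik_spec (S k).
apply/ik_linear_dominates.
(* If i_S(k) is reached at (j, n), then i_k + d = n + j S(k) + j d >= i_k + j d, which forces j <=
   1. The case j = 0 is excluded by b_0 = 0, and j = 1 gives i_k = n + S(k) >= w + S(k). *)
pose d := S (S k) - S k; have d_gt0 : 0 < d by rewrite grlex_subr_gt0 lt_grlex_succ.
have Sd : S (S k) = S k + d by rewrite addrC subrK.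
have eq_d : ik P y0 k + d = n + S k *+ j + d *+ j.
  by rewrite -addrA -mulrnDl -Sd -e' e /d addrA addrAC.
case: j bn eq_d {e'} => [|[|j]] bn eq_d.
- by rewrite coef_b0 hcoef0 eqxx in bn.
- move/addIr: eq_d => eq_d; apply/le_anti.
  by rewrite {2}eq_d mulr1n grlex_leD2r b1_ge // -{1}(mulr1n (S k)) lb.
- suff : ik P y0 k + d < n + S k *+ j.+2 + d *+ j.+2 by rewrite eq_d ltxx.
  rewrite ![ik _ _ _ + _]addrC ![_ + d *+ _]addrC; apply: grlex_ltD; last exact: lb.
  rewrite -[X in X < _](addr0 d) mulrS [d + 0]addrC [d + _]addrC.
  apply: grlex_ltD => //; rewrite -(mul0rn (zvec r) j.+1); exact: grlex_mulrn_lt.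
Qed.

(** Only finitely many b_j are nonzero, so the degrees of all w - n are bounded by one N; any k in
    N^r of degree at least N then exceeds every w - n, and the linear term dominates. *)
Lemma k0_cond_exists : exists k, k0_cond P y0 k.
Proof.
have [N hN] : exists N : nat, forall j n, b`_j n != 0 -> zdeg (w - n) < N%:Z.
  have h j : exists N : nat, forall n, b`_j n != 0 -> zdeg (w - n) < N%:Z.
    have := hval_spec b`_j; case: (hval _) => [m [_ m_le]|b0].
      exists `|zdeg (w - m)|.+1 => n /m_le mn.
      apply: (@le_lt_trans _ _ (zdeg (w - m))); first by rewrite zdeg_le // grlex_leB.
      by apply: le_lt_trans (lez_abs _) _; rewrite ltz_nat.
    by exists 0 => n; rewrite b0 hcoef0 eqxx.
  pose N j := xget 0 [set N : nat | forall n, b`_j n != 0 -> zdeg (w - n) < N%:Z].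
  have hN j : forall n, b`_j n != 0 -> zdeg (w - n) < (N j)%:Z.
    exact: (xgetPex 0 (h j)).
  exists (\max_(j < size b) N j)%N => j n bn.
  have jb : (j < size b)%N.
    by rewrite ltnNge; apply: contra bn => /(nth_default 0) ->; rewrite hcoef0.
  apply: lt_le_trans (hN _ _ bn) _; rewrite lez_nat.
  exact: (leq_bigmax (Ordinal jb)).
have [k k_nat kN] := natvec_large r_gt0 N.
exists k; apply/k0_condE; split=> // -[|[|j]] n bn.
- by rewrite coef_b0 hcoef0 eqxx in bn.
- by rewrite mulr1n grlex_leD2r b1_ge.
- rewrite mulrSr addrA grlex_leD2r addrC -grlex_leBlDr.
  apply: (@le_trans _ _ k); first by apply/ltW/zdeg_lt/(lt_le_trans (hN _ _ bn)).
  apply: (@le_trans _ _ (S k)); first exact/ltW/lt_grlex_succ.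
  rewrite mulrS -[X in X <= _]addr0 grlex_leD2l.
  rewrite -(mul0rn (zvec r) j); apply: grlex_mulrn; apply: natvec_ge0.
  exact: natvec_succ.
Qed.

(** N^r is well ordered, so the least index exists and the default of [k0] is not returned. *)
Lemma k0_condP : k0_cond P y0 (k0 P y0).
Proof.
suff : exists k, [set k | k0_cond P y0 k /\ forall l, k0_cond P y0 l -> k <= l] k.
  by move=> /(xgetPex 0)[].
have [|k ck lb] := wo_natvec (X := k0_cond P y0) _ k0_cond_exists.
  by move=> k [].
by exists k.
Qed.

Lemma ik_k0 : ik P y0 (k0 P y0) = w + S (k0 P y0).
Proof. by apply/ik_linear_dominates; case/k0_condE: k0_condP. Qed.

(** c_S(k_0) is the constant coefficient of T, so omega_0 is the coefficient of u^(i_k_0) in the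
    derivative of P_k_0 evaluated at T; there i_k_0 = w + S(k_0). *)
Lemma omega0E : omega0 P y0 = b`_1 w.
Proof.
rewrite /omega0 -/(lowest_poly _ _) deriv_lowest_poly -hcoef_shifted_tail0 //.
set k := k0 _ _.
have Pk_ge : Pk P y0 k \is a polyOver (vge (ik P y0 k)).
  have [lb _] := ik_spec k; rewrite PkE -polyCN.
  apply: polyOver_vge_comp; last by rewrite polyOver_XD ?rpredN ?shifted_tail_vring.
  apply/polyOverP => j; apply/supp_inP => n; rewrite coef_B => /lb.
  by rewrite subrK.
rewrite horner_lowest_poly ?shifted_tail_vring //; last first.
  by apply/polyOverP => j; rewrite coef_deriv rpredMn // (polyOverP Pk_ge).
(* By the chain rule this derivative at T is u^S(k_0) dP/dy (u, y_0), because the inner polynomial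
   takes the value y_0 at T. *)
rewrite /Pk deriv_comp hornerM horner_comp derivD derivC add0r derivZ derivX.
rewrite alg_polyC hornerC hornerD hornerC hornerZ hornerX [_ * T k]mulrC.
rewrite divr_hmonomK addrCA subrr addr0 -coef_b1 mulrC hcoef_monomM mul1r.
by rewrite ik_k0 addrK.
Qed.

(** * The Henselian equation beyond k_0 *)

Variable k : zvec r.
Hypothesis k_nat : natvec k.
Hypothesis k_gt : k0 P y0 < k.

Local Notation om := (omega0 P y0).
Local Notation t := (tail y0 (S k)).
(** R_k written in the variable y - t, as [RkE] shows. *)
Local Notation C := (hmonom (- om)^-1 (- ik P y0 k) *: B k).

Lemma omega0_neq0 : om != 0.
Proof. by rewrite omega0E. Qed.

Lemma higher_gt j n : b`_j.+2 n != 0 -> w + S k < n + S k *+ j.+2.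
Proof.
by apply: linear_dominates_lt k_nat k_gt _ j n; case/k0_condE: k0_condP.
Qed.

Lemma ik_gt_k0 : ik P y0 k = w + S k.
Proof.
apply/ik_linear_dominates => -[|[|j]] n bn; last exact/ltW/higher_gt.
  by rewrite coef_b0 hcoef0 eqxx in bn.
by rewrite mulr1n grlex_leD2r b1_ge.
Qed.

(** T = t + c_S(k), so replacing y by y + c_S(k) turns y - T into y - t. *)
Lemma RkE : Rk P y0 k = C \Po ('X - t%:P).
Proof.
rewrite /Rk PkE hmonomV ?oppr_eq0 ?omega0_neq0 // comp_polyZ; congr (_ *: _).
rewrite -comp_polyA; congr (_ \Po _).
by rewrite comp_polyB comp_polyX comp_polyC shifted_tail_succ polyCD opprD addrACA subrr addr0.
Qed.

Lemma coef_C j n : C`_j n = (- om)^-1 * b`_j (n + (w + S k) - S k *+ j).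
Proof. by rewrite coefZ hcoef_monomM opprK coef_B ik_gt_k0. Qed.

Lemma coef_C0 : C`_0 = 0.
Proof. by apply: hahnP => n; rewrite coef_C coef_b0 !hcoef0 mulr0. Qed.

(** The linear coefficient of [C] starts with b_1(w) / (- omega_0) = -1 at exponent 0, which 'X
    cancels. The constant one vanishes, and the others have positive value by [higher_gt]. *)
Lemma C_vgt : C + 'X \is a polyOver (vgt 0).
Proof.
apply/polyOverP => j; apply/supp_inP => n; rewrite coefD coefX hcoefD.
case: j => [|[|j]].
- by rewrite coef_C0 [1 *+ _]mulr0n hcoef0 addr0 eqxx.
- rewrite coef_C mulr1n addrA addrK [X in _ + X]/=.
  have [->|n0] := eqVneq n 0.
    by rewrite add0r -omega0E invrN mulNr mulVf ?omega0_neq0 // addNr eqxx.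
  rewrite addr0 mulf_eq0 negb_or => /andP[_ /b1_ge].
  by rewrite -[X in X <= _](add0r w) grlex_leD2r /= lt_neqAle eq_sym n0.
- rewrite coef_C [1 *+ _]mulr0n hcoef0 addr0 mulf_eq0 negb_or => /andP[_ /higher_gt].
  by rewrite subrK -[X in X < _](add0r (w + S k)) grlex_ltD2r.
Qed.

(** Obtained from C(y - t) = - (y - t) + (C + X)(y - t) by moving - y aside. *)
Definition henselQ : {poly hahn K r} := t%:P + ((C + 'X) \Po ('X - t%:P)).

Lemma Rk_henselQ : Rk P y0 k = - 'X + henselQ.
Proof.
rewrite RkE /henselQ comp_polyD comp_polyX; set D := _ \Po _.
by rewrite [D + _]addrA [t%:P + _]addrC subrK [D + _]addrC addKr.
Qed.

(** C + X has no constant term, since P(y_0) = 0. *)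
Lemma henselQ_tail : t = henselQ.[t].
Proof.
rewrite /henselQ hornerD hornerC horner_comp hornerXsubC subrr.
by rewrite horner_coef0 coefD coef_C0 coefX !addr0.
Qed.

Lemma tail_vring : t \in vring.
Proof. by apply/supp_inP => n /(supp_inP _ _ (tail_vgt (S k)))/ltW. Qed.

Lemma henselQ_vgt : henselQ \is a polyOver (vgt 0).
Proof.
rewrite rpredD ?polyOverC ?tail_vgt // -polyCN.
by apply: polyOver_vgt_comp C_vgt _; rewrite polyOver_XD ?rpredN ?tail_vring.
Qed.

Hypothesis P_series : P \is a polyOver pseries.

(** Before the division by a monomial all coefficients are power series. *)
Lemma Rk_mod : Rk P y0 k \is a polyOver modseries.
Proof.
have u_series m c : natvec m -> hmonom c m \in @pseries K r by apply: supp_in_monom.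
have PkX : Pk P y0 k \Po ('X + (hmonom (y0 (S k)) 0)%:P) \is a polyOver pseries.
  rewrite !polyOver_comp // rpredD ?polyOverZ ?polyOverX ?polyOverC //.
  - exact: zpart_series.
  - exact/u_series/natvec_succ.
  - exact/u_series/natvec0.
apply/polyOverP => j; rewrite coefZ hmonomV ?oppr_eq0 ?omega0_neq0 //.
exact/modseriesM_monom/(polyOverP PkX).
Qed.

Lemma henselQ_mod : henselQ \is a polyOver modseries.
Proof.
have -> : henselQ = Rk P y0 k + 'X by rewrite Rk_henselQ addrAC addNr add0r.
apply/polyOverP => j; rewrite coefD rpredD ?(polyOverP Rk_mod) // coefX.
(* The coefficient 0 or 1 of 'X is viewed as u^0 times a power series. *)
rewrite -[_%:R]mul1r -[1](_ : hmonom 1 0 = 1) // modseriesM_monom //.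
by case: (_ == _); rewrite ?rpred1 ?rpred0.
Qed.

(** Q(0) = R_k(0) is P(z_k + c_S(k) u^S(k)) = P(z_S(k)) up to an invertible monomial. *)
Lemma henselQ_horner0 : henselQ.[0] = 0 -> root P (zpart y0 (S k)).
Proof.
have -> : henselQ = Rk P y0 k + 'X by rewrite Rk_henselQ addrAC addNr add0r.
rewrite hornerD hornerX addr0 hornerZ /Pk !horner_comp.
rewrite !(hornerD, hornerC, hornerZ, hornerX) add0r hmonomM mul1r addr0.
rewrite -zpart_succ -[RHS](mulr0 (hmonom (- om) (ik P y0 k))^-1) => /mulrI e.
by apply/eqP/e; rewrite unitrV hmonom_unit // oppr_eq0 omega0_neq0.
Qed.

End Expansion.

Theorem theorem7p5 (K : fieldType) (K_char0 : [pchar K] =i pred0)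
    (r : nat) (r_ge2 : (2 <= r)%N)
    (dy : nat) (P : {poly hahn K r}) (P_series : P \is a polyOver pseries)
    (P_neq0 : P != 0) (P_deg : (size P <= dy.+1)%N)
    (y0 : hahn K r) (y0_series : y0 \in pseries) (c0_neq0 : y0 0 != 0)
    (y0_root : root P y0) (y0_simple : P^`().[y0] != 0)
    (k : zvec r) (k_nat : natvec k) (k_gt : k0 P y0 < k) :
  root P (zpart y0 (grlex_succ k)) \/
  exists Q : {poly hahn K r},
    [/\ Rk P y0 k = - 'X + Q,
        Rk P y0 k \is a polyOver modseries,
        strongly_reduced_henselian Q,
        tail y0 (grlex_succ k) = Q.[tail y0 (grlex_succ k)]
      & is_hsum (fun j : nat =>
                   hmonom (y0 (iter j.+2 grlex_succ k))
                          (iter j.+2 grlex_succ k - grlex_succ k))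
                (tail y0 (grlex_succ k))].
Proof.
have r_gt0 : (0 < r)%N by apply: leq_trans r_ge2.
have [|z_notroot] := boolP (root P (zpart y0 (grlex_succ k))); [by left | right].
have /eqP P_y0 := y0_root.
(* w is the value of dP/dy (u, y_0), finite because the root is simple. *)
have [w [b1_w b1_ge]] : exists w : zvec r,
    P^`().[y0] w != 0 /\ forall n, P^`().[y0] n != 0 -> w <= n.
  have := hval_spec P^`().[y0]; case: (hval _) => [w|e]; first by exists w.
  by rewrite e eqxx in y0_simple.
rewrite -!coef_b1 in b1_w b1_ge.
exists (henselQ P y0 k); split.
- exact (Rk_henselQ r_gt0 y0_series y0_simple P_y0 b1_w b1_ge k).
- exact (Rk_mod r_gt0 y0_series y0_simple P_y0 b1_w b1_ge k P_series).
- split; first exact (henselQ_mod r_gt0 y0_series y0_simple P_y0 b1_w b1_ge k P_series).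
    apply: wlt_pval; exact (henselQ_vgt r_gt0 y0_series y0_simple P_y0 b1_w b1_ge k_nat k_gt).
  apply: contra z_notroot => /eqP.
  by apply (henselQ_horner0 r_gt0 y0_series y0_simple P_y0 b1_w b1_ge).
- exact (henselQ_tail r_gt0 y0_series y0_simple P_y0 b1_w b1_ge k_nat k_gt).
(* The iterates from [j.+2] on, started at k, are those from [j.+1] on, started at S(k). *)
- rewrite (_ : (fun j => _) = fun j => hmonom
      (y0 (iter j.+1 grlex_succ (grlex_succ k)))
      (iter j.+1 grlex_succ (grlex_succ k) - grlex_succ k)); first exact: tail_hsum.
  by apply/funext => j; rewrite iterSr.
Qed.
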